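(* Let $K\ge 1$ be an integer and let $r_0\sim\mathcal{U}(0,1)$. Let $\mathbf{c}_n=(c_n^1,\dots,c_n^K)$, $n\ge 0$, be random vectors such that all the $c_n^i$ ($n\ge0$, $1\le i\le K$) are i.i.d. with distribution $\mathcal{U}(0,1)$ and independent of $r_0$. Consider the random $(K+1)$-section algorithm: $r_{n+1}=T_{K+1}(\mathbf{c}_n,r_n)$ and $\ell_{n+1}=\ell_{K+1}(\mathbf{c}_n,r_n)$ for $n\ge 0$, with $T_{K+1}$ and $\ell_{K+1}(\cdot,\cdot)$ as given in the context. Then $$\mathbb{E}[\ell_n]=\frac{2}{K+2}\qquad\text{for all } n>0.$$
   Context: $\mathcal{U}(0,1)$ is the uniform distribution on $(0,1)$. For $\mathbf{c}=(c^1,\dots,c^K)\in[0,1]^K$, let $c^{(1)}\le\dots\le c^{(K)}$ be its entries in nondecreasing order, and set $c^{(0)}:=0$, $c^{(K+1)}:=1$. If $c^{(i)}\le r<c^{(i+1)}$ with $i\in\{0,\dots,K\}$, define $$T_{K+1}(\mathbf{c},r)=\frac{r-c^{(i)}}{c^{(i+1)}-c^{(i)}},\qquad \ell_{K+1}(\mathbf{c},r)=c^{(i+1)}-c^{(i)}.$$ For $r=1$ (an event of probability zero) arbitrary values in $[0,1]$ are assigned, say $1$ for both. At each iteration, the current interval (rescaled to $[0,1]$) is cut at $K$ independent uniform points, the subinterval containing the root is kept and rescaled to $[0,1]$; $r_n$ is the rescaled root and $\ell_{n+1}$ the factor by which the interval length is multiplied. *)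

(* Defs.v *)
From HB Require Import structures.
From mathcomp Require Export all_boot all_order all_algebra.
From mathcomp Require Export all_classical all_reals all_analysis.

Set Implicit Arguments.
Unset Strict Implicit.
Unset Printing Implicit Defensive.

Import Order.TTheory GRing.Theory Num.Theory.
Import numFieldNormedType.Exports.

Local Open Scope classical_set_scope.
Local Open Scope ring_scope.

(* The library's measures are functions on all sets, but two laws are to be
   compared on measurable sets only. *)
Definition uniform01 d (Omega : measurableType d) (R : realType)
    (P : probability Omega R) (X : {RV P >-> R}) : Prop :=
  forall A : set R, measurable A ->
    distribution P X A = uniform_prob (@ltr01 R) A.

Definition mutually_independent d (Omega : measurableType d) (R : realType)
    (P : probability Omega R) (I : eqType) (X : I -> {RV P >-> R}) : Prop :=
  forall (s : seq I) (A : I -> set R),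
    uniq s -> (forall i, i \in s -> measurable (A i)) ->
    P (\bigcap_(i in [set` s]) (X i @^-1` A i)) =
    (\prod_(i <- s) P (X i @^-1` A i))%E.

(* r_0 (index None) together with all the cut points c_n^i (index Some (n, i)). *)
Definition root_and_cuts d (Omega : measurableType d) (R : realType)
    (P : probability Omega R) (K : nat) (r0 : {RV P >-> R})
    (c : nat -> 'I_K -> {RV P >-> R}) (k : option (nat * 'I_K)) :
    {RV P >-> R} :=
  if k is Some (n, i) then c n i else r0.

(* c^(i) for 0 <= i <= K+1, with c^(0) = 0 and c^(K+1) = 1. *)
Definition order_stat (R : realType) (K : nat) (c : 'I_K -> R) (i : nat) : R :=
  nth 0 (0 :: rcons (sort <=%R (codom c)) 1) i.

(* The index i in {0, ..., K} such that c^(i) <= r < c^(i+1). For c in [0, 1]^K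
   and r in [0, 1] it is unique, and exists unless r = 1, a null event on which
   the two functions below take the value 1. *)
Definition cell_index (R : realType) (K : nat) (c : 'I_K -> R) (r : R) :
    option 'I_K.+1 :=
  [pick i : 'I_K.+1 | order_stat c i <= r < order_stat c i.+1].

Definition section_root (R : realType) (K : nat) (c : 'I_K -> R) (r : R) : R :=
  if cell_index c r is Some i
  then (r - order_stat c i) / (order_stat c i.+1 - order_stat c i)
  else 1.

Definition section_length (R : realType) (K : nat) (c : 'I_K -> R) (r : R) : R :=
  if cell_index c r is Some i
  then order_stat c i.+1 - order_stat c i
  else 1.

(* Main.v *)
From HB Require Import structures.
From mathcomp Require Import measurable_realfun ring lra.
Require Import Defs.

(** Why the expected length is 2 / (K + 2) at every step.

    For fixed cuts, one step maps each cell of [0, 1[ affinely onto [0, 1[, so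
    it preserves the uniform law ([unif_cell_root]), and so does any composition
    of steps ([unif_iter_root]). The n-th root is such a composition, determined
    by the cuts, applied to the initial root. The initial root is independent of
    all the cuts, so it may be integrated out while the cuts are frozen
    ([integral_freeze]); after that the n-th root can be replaced by a uniform
    point. In this way no independence between the n-th root and the later cuts
    has to be carried through an induction.

    It remains to find the expected length of the cell of a uniform point u for
    K independent uniform cuts ([expected_cell_length]). This length is the
    probability that another uniform point v falls into the cell of u, that is,
    that no cut separates u from v. A cut does so with probability |u - v|, so
    the expectation is the double integral of (1 - |u - v|)^K over the unit
    square ([probability_same_cell]), which is elementary ([integral_gap_pow],
    [integral_gap_pow_sum]).

    Two technical points shape the statements. Cells are described through the
    relation that no cut separates two points, and lengths as measures of cells,
    so that joint measurability in cuts and root comes from sections of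
    measurable sets. The given lengths agree with these expressions almost
    everywhere, and [ge0_ae_eq_integralT] compares the integrals of arbitrary
    nonnegative functions that agree in this sense. *)

Set Implicit Arguments.
Unset Strict Implicit.
Unset Printing Implicit Defensive.

Import Order.TTheory GRing.Theory Num.Theory.
Import numFieldNormedType.Exports.

Local Open Scope classical_set_scope.
Local Open Scope ring_scope.

Local Notation unif := (uniform_prob (@ltr01 _)).

(** * The uniform law on the unit interval *)

Section uniform.
Context {R : realType}.

Lemma unif_itv (x y : bool) (a b : R) : 0 <= a -> a <= b -> b <= 1 ->
  unif [set` Interval (BSide x a) (BSide y b)] = (b - a)%:E.
Proof.
move=> a0 ab b1; rewrite /uniform_prob.
under eq_integral => z.
  rewrite inE/= itv_boundlr/= => /andP[az zb].
  have {}az : a <= z by case: x az => //= /ltW.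
  have {}zb : z <= b by case: y zb => //= /ltW.
  rewrite /uniform_pdf (le_trans a0 az) (le_trans zb b1)/= subr0 invr1.
  over.
rewrite integral_cst//= mul1e lebesgue_measure_itv/= lte_fin.
move: ab; rewrite le_eqVlt => /orP[/eqP ->|->]; last by rewrite EFinB.
by rewrite ltxx subrr.
Qed.

(** Reduces every computation to [0, 1[, where the cells are defined. *)
Lemma unif_setI01 (A : set R) : measurable A -> unif A = unif (A `&` `[0, 1[).
Proof.
move=> mA; set I := `[0, 1[%classic.
have mI : measurable I by exact: measurable_itv.
have -> : unif A = (unif (A `\` I) + unif (A `&` I))%E.
  exact: measureDI.
rewrite -[RHS]add0e; congr (_ + _)%E.
apply/eqP; rewrite eq_le measure_ge0 andbT.
have <- : unif (~` I) = 0%E.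
  transitivity (1 - unif I)%E; first exact: probability_setC.
  by rewrite unif_itv// subr0 subee.
apply: le_measure; rewrite ?inE.
- exact: measurableD.
- exact: measurableC.
- by move=> x [].
Qed.

(** The half-lines below the points of ]0, 1] determine a probability measure
    with the uniform distribution function: the value at 1 and the limit at 0
    force all the mass into ]0, 1[, which gives the other half-lines. *)
Lemma unif_cdf_unique (m : probability (measurableTypeR R) R) :
  (forall x : R, 0 < x -> x <= 1 -> m `]-oo, x[%classic = x%:E) ->
  forall A : set R, measurable A -> m A = unif A.
Proof.
move=> mE A mA; pose rays : set (set R) := [set `]-oo, x[%classic | x in setT].
have mray (x : R) : measurable (`]-oo, x[%classic : set R).
  exact: measurable_itv.
have m1 : m `]-oo, (1 : R)[%classic = 1%E by rewrite mE.
have m0 : m `]-oo, (0 : R)]%classic = 0%E.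
  apply/eqP; rewrite eq_le measure_ge0 andbT; apply/lee_addgt0Pr => e e0.
  rewrite add0e; pose f := Num.min e 1.
  have f0 : 0 < f by rewrite lt_min e0 ltr01.
  apply: (@le_trans _ _ f%:E); last by rewrite lee_fin ge_min lexx.
  rewrite -mE// ?ge_min ?lexx ?orbT//.
  apply: le_measure; rewrite ?inE//.
  by move=> y /=; rewrite !in_itv/= => /le_lt_trans; apply.
apply: (@measure_unique _ R (measurableTypeR R) rays
  (fun n => `]-oo, n%:R[%classic) _ _ _ _ m unif _ _ A mA) => //.
- rewrite (measurable_realfun.RGenInftyO.measurableE R); congr (<<s _ >>).
  apply/seteqP; split => [_ [x ->]|_ [x _ <-]]; first by exists x.
  by exists x.
- move=> _ _ [x _ <-] [y _ <-]; exists (Num.min x y) => //.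
  by apply/seteqP; split => z /=; rewrite !in_itv/= lt_min => /andP.
- by move=> n; exists n%:R.
- apply/seteqP; split => // x _; exists (Num.truncn `|x|).+1 => //=.
  rewrite in_itv/=; apply: (le_lt_trans (ler_norm _)).
  exact: truncnS_gt.
- move=> _ [x _ <-]; have [x0|x0] := leP x 0; last have [x1|x1] := leP x 1.
  + transitivity (0%E : \bar R).
      apply/eqP; rewrite eq_le measure_ge0 andbT -m0.
      apply: le_measure; rewrite ?inE//.
      by move=> y /=; rewrite !in_itv/= => yx; rewrite (le_trans (ltW yx)).
    rewrite [RHS]unif_setI01// (_ : _ `&` _ = set0) ?measure0//.
    apply/seteqP; split => // y /=; rewrite !in_itv/= => -[yx /andP[y0 _]].
    by move: (le_lt_trans y0 (lt_le_trans yx x0)); rewrite ltxx.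
  + rewrite [LHS](mE _ x0 x1) [RHS]unif_setI01//.
    rewrite (_ : _ `&` _ = `[0, x[%classic).
      by rewrite unif_itv ?subr0// ltW.
    apply/seteqP; split => y /=; rewrite !in_itv/=.
      by move=> [-> /andP[->]].
    by move=> /andP[-> yx]; rewrite yx (lt_le_trans yx).
  + transitivity (1%E : \bar R).
      apply/eqP; rewrite eq_le probability_le1//= -m1.
      apply: le_measure; rewrite ?inE//.
      by move=> y /=; rewrite !in_itv/= => /lt_trans; apply.
    rewrite [RHS]unif_setI01// (_ : _ `&` _ = `[0, 1[%classic).
      by rewrite unif_itv ?subr0.
    apply/seteqP; split => y /=; rewrite !in_itv/=.
      by move=> [_].
    by move=> /andP[-> y1]; rewrite y1 (lt_trans y1).
- move=> k; rewrite -ge0_fin_numE//; exact: fin_num_measure.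
Qed.

End uniform.

(** * Cells cut out by the order statistics *)

(** This says that no cut lies between [u] and [v]. Unlike a description through
    sorted cuts, it is visibly measurable in all its arguments and it is a
    conjunction of one condition per cut, so that independence applies to it. *)
Definition same_cell (R : realType) (K : nat) (c : 'I_K -> R) (u v : R) :=
  [forall i, (c i <= u) == (c i <= v)].

Section cells.
Context {R : realType} {K : nat}.
Variable c : 'I_K -> R.
Hypothesis c01 : forall i, 0 <= c i <= 1.
Local Notation os := (order_stat c).

Let size_os : size (0 :: rcons (sort <=%R (codom c)) 1) = K.+2.
Proof. by rewrite /= size_rcons size_sort size_codom card_ord. Qed.

Lemma order_stat0 : os 0 = 0. Proof. by []. Qed.

Lemma order_stat_last : os K.+1 = 1.
Proof.
by rewrite /order_stat /= nth_rcons size_sort size_codom card_ord ltnn eqxx.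
Qed.

Lemma order_stat_le i j : (i <= j)%N -> (j <= K.+1)%N -> os i <= os j.
Proof.
move=> ij jK; apply: (le_sorted_leq_nth _ _ _ _ ij);
  rewrite ?inE ?size_os ?ltnS// ?(leq_trans ij)//.
rewrite le_sorted_pairwise pairwise_cons pairwise_rcons.
rewrite -le_sorted_pairwise sort_le_sorted andbT; apply/andP; split.
  apply/allP => x; rewrite mem_rcons inE => /predU1P[->|] //=.
  by rewrite mem_sort => /codomP[k ->]; case/andP: (c01 k).
apply/allP => x; rewrite mem_sort => /codomP[k ->].
by case/andP: (c01 k).
Qed.

Lemma order_statP i : (i <= K.+1)%N ->
  [\/ os i = 0, os i = 1 | exists j, os i = c j].
Proof.
move=> iK; have : os i \in 0 :: rcons (sort <=%R (codom c)) 1.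
  by apply: mem_nth; rewrite size_os ltnS.
rewrite inE => /predU1P[->|]; first by constructor 1.
rewrite mem_rcons inE => /predU1P[->|]; first by constructor 2.
by rewrite mem_sort => /codomP[j ->]; constructor 3; exists j.
Qed.

Lemma cut_order_stat j : exists2 k, (k <= K.+1)%N & c j = os k.
Proof.
have jI : c j \in 0 :: rcons (sort <=%R (codom c)) 1.
  by rewrite inE mem_rcons inE mem_sort codom_f !orbT.
exists (index (c j) (0 :: rcons (sort <=%R (codom c)) 1)).
  by rewrite -ltnS -size_os index_mem.
by rewrite /order_stat nth_index.
Qed.

(** The right end is the first order statistic above [u]. *)
Lemma cell_exists u : 0 <= u < 1 -> exists i : 'I_K.+1, os i <= u < os i.+1.
Proof.
move=> /andP[u0 u1].
have ex : exists k, u < os k by exists K.+1; rewrite order_stat_last.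
case: (ex_minnP ex) => -[|k] uk kmin.
  by move: uk; rewrite order_stat0 ltNge u0.
have kK : (k < K.+1)%N by apply: kmin; rewrite order_stat_last.
exists (Ordinal kK); rewrite uk andbT /= leNgt.
by apply/negP => /kmin; rewrite ltnn.
Qed.

Lemma cell_unique (i j : 'I_K.+1) u :
  os i <= u < os i.+1 -> os j <= u < os j.+1 -> i = j.
Proof.
wlog : i j / (i <= j)%N => [wlogij ui uj|ij /andP[_ ui] /andP[uj _]].
  have [|/ltnW] := leqP i j => ij; first exact: wlogij.
  by apply/esym; exact: wlogij.
apply/val_inj/eqP; rewrite eqn_leq ij /= leqNgt; apply/negP => lt_ij.
have := lt_le_trans ui (order_stat_le lt_ij (ltnW (ltn_ord j))).
by rewrite ltNge uj.
Qed.

(** Each end of the cell is 0, 1 or a cut, and every cut is an order statistic,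
    hence lies at or below the left end or at or above the right end. *)
Lemma same_cellE (i : 'I_K.+1) u v : os i <= u < os i.+1 -> 0 <= v < 1 ->
  same_cell c u v = (os i <= v < os i.+1).
Proof.
move=> /andP[iu ui] /andP[v0 v1].
have iK : (i <= K.+1)%N by rewrite ltnW.
apply/forallP/andP => [same|[iv vi] j].
  split.
    case: (order_statP iK) => [-> //|i1|[j ij]].
    - have := order_stat_le (ltn_ord i) (leqnn _).
      by rewrite order_stat_last leNgt -{1}i1 (le_lt_trans iu ui).
    - by rewrite ij -(eqP (same j)) -ij.
  case: (order_statP (ltn_ord i)) => [i0|->//|[j ij]].
  - have := le_lt_trans iu ui.
    by rewrite i0 ltNge -order_stat0 order_stat_le.
  - by rewrite ij ltNge -(eqP (same j)) -ltNge -ij.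
have [k kK ->] := cut_order_stat j; have [ki|ik] := leqP k i.
  by rewrite !(le_trans (order_stat_le ki iK)).
by rewrite !leNgt !(lt_le_trans _ (order_stat_le ik kK)).
Qed.

End cells.

(** * One step for fixed cuts preserves the uniform law *)

(* Otherwise [/=] unfolds the order statistics into list lookups. *)
#[local] Arguments order_stat : simpl never.

Section measurability.
Context {R : realType} {K : nat} {d : measure_display} {T : measurableType d}.

Lemma measurable_setb (b : T -> bool) :
  measurable_fun setT b -> measurable [set t | b t].
Proof.
by move=> mb; rewrite -[X in measurable X]setTI; exact: (mb _ [set true]).
Qed.

Lemma measurable_same_cell (X : 'I_K -> T -> R) (f g : T -> R) :
  (forall i, measurable_fun setT (X i)) ->
  measurable_fun setT f -> measurable_fun setT g ->
  measurable [set t | same_cell (X^~ t) (f t) (g t)].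
Proof.
move=> mX mf mg.
rewrite (_ : [set t | _] = \bigcap_(i in [set: 'I_K])
    [set t | (X i t <= f t) == (X i t <= g t)]); last first.
  apply/seteqP; split => t /=.
    by move=> /forallP + i _ => /(_ i).
  by move=> H; apply/forallP => i; exact: H.
apply: fin_bigcap_measurable => // i _.
have mle h : measurable_fun setT h ->
    measurable_fun setT (fun t => X i t <= h t).
  exact: measurable_fun_ler.
rewrite (_ : [set t | _] = [set t | (X i t <= f t) && (X i t <= g t) ||
    ~~ (X i t <= f t) && ~~ (X i t <= g t)]); last first.
  by apply/seteqP; split => t /=; case: (X i t <= f t); case: (X i t <= g t).
apply: measurable_setb; apply: measurable_or; apply: measurable_and;
  by [exact: mle|apply: measurable_neg; exact: mle].
Qed.

End measurability.

Section cell_measure.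
Context {R : realType} {K : nat}.
Implicit Type c : 'I_K -> R.

(** The length of the cell of [u] as the probability that a second uniform point
    falls into that cell. This form is jointly measurable in the cuts and [u],
    because the measure of the sections of a measurable set is measurable. *)
Definition cell_length c (u : R) : R := fine (unif [set v | same_cell c u v]).

(** The fraction of the cell of [u] that lies to the left of [u]. *)
Definition cell_root c (u : R) : R :=
  fine (unif ([set v | same_cell c u v] `&` [set v | v < u])) / cell_length c u.

Section measurable.
Context {d : measure_display} {T : measurableType d}.
Variables (X : 'I_K -> T -> R) (f : T -> R).
Hypothesis mX : forall i, measurable_fun setT (X i).
Hypothesis mf : measurable_fun setT f.

Let msame : measurable [set tv : T * R | same_cell (X^~ tv.1) (f tv.1) tv.2].
Proof.
apply: (@measurable_same_cell R K _ (T * R)%type (fun i => X i \o fst)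
  (f \o fst) snd).
- by move=> i; exact: measurableT_comp.
- exact: measurableT_comp.
- exact: measurable_snd.
Qed.

Let measurable_fine_section (A : set (T * R)) : measurable A ->
  measurable_fun setT (fun t => fine (unif [set v | A (t, v)])).
Proof.
move=> mA; apply: measurableT_comp => //.
have := measurable_fun_xsection unif mA.
by apply: eq_measurable_fun => t _ /=; rewrite xsectionE.
Qed.

Lemma measurable_cell_length :
  measurable_fun setT (fun t => cell_length (X^~ t) (f t)).
Proof. exact: measurable_fine_section msame. Qed.

Lemma measurable_cell_root :
  measurable_fun setT (fun t => cell_root (X^~ t) (f t)).
Proof.
have mleft : measurable ([set tv : T * R | same_cell (X^~ tv.1) (f tv.1) tv.2]
    `&` [set tv | tv.2 < f tv.1]).
  apply: measurableI => //; apply: measurable_setb; apply: measurable_fun_ltr.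
    exact: measurable_snd.
  exact: measurableT_comp.
apply: measurable_funM; first exact: measurable_fine_section mleft.
(* Powers with a real exponent are measurable, and the exponent -1 is the
   inverse on nonnegative numbers such as lengths. *)
apply: (@eq_measurable_fun _ _ _ _ _
  (fun t => cell_length (X^~ t) (f t) `^ (-1))).
  by move=> t _; rewrite powR_inv1// fine_ge0.
exact: measurableT_comp (measurable_powR (-1)) measurable_cell_length.
Qed.

End measurable.

Section cellE.
Variables (c : 'I_K -> R).
Hypothesis c01 : forall i, 0 <= c i <= 1.
Local Notation os := (order_stat c).

Let os01 (i : nat) : (i <= K.+1)%N -> 0 <= os i <= 1.
Proof.
by move=> iK; rewrite -{1}(order_stat0 c) -(order_stat_last c) !order_stat_le.
Qed.

Lemma unif_same_cell (i : 'I_K.+1) u A : measurable A ->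
  os i <= u < os i.+1 ->
  unif ([set v | same_cell c u v] `&` A) = unif (`[os i, os i.+1[ `&` A).
Proof.
move=> mA ui; have mc : measurable [set v | same_cell c u v].
  exact: (@measurable_same_cell R K _ R (fun i _ => c i) (fun=> u) id).
rewrite [LHS]unif_setI01; last exact: measurableI.
congr (unif _); apply/seteqP; split => v /=; rewrite !in_itv/=.
  by move=> [[+ Av] v01]; rewrite (same_cellE c01 ui).
move=> [iv Av]; have v01 : 0 <= v < 1.
  have /andP[vi iv1] := iv.
  have /andP[i0 _] := os01 (ltnW (ltn_ord i)).
  have /andP[_ i1] := os01 (ltn_ord i).
  by rewrite (le_trans i0)// (lt_le_trans iv1).
by rewrite (same_cellE c01 ui).
Qed.

Lemma cell_lengthE (i : 'I_K.+1) u : os i <= u < os i.+1 ->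
  cell_length c u = os i.+1 - os i.
Proof.
move=> ui; have /andP[i0 _] := os01 (ltnW (ltn_ord i)).
have /andP[_ i1] := os01 (ltn_ord i).
rewrite /cell_length -[X in unif X]setIT (unif_same_cell _ ui)// setIT.
by rewrite unif_itv// order_stat_le.
Qed.

Lemma cell_rootE (i : 'I_K.+1) u : os i <= u < os i.+1 ->
  cell_root c u = (u - os i) / (os i.+1 - os i).
Proof.
move=> ui; have /andP[i0 _] := os01 (ltnW (ltn_ord i)).
have /andP[_ i1] := os01 (ltn_ord i).
rewrite /cell_root (cell_lengthE ui); congr (_ / _).
have mlt : measurable [set v : R | v < u].
  by apply: measurable_setb; exact: measurable_fun_ltr.
rewrite (unif_same_cell mlt ui) (_ : _ `&` _ = `[os i, u[%classic).
  by case/andP: ui => iu /ltW ui; rewrite unif_itv// (le_trans ui).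
apply/seteqP; split => v /=; rewrite !in_itv/=.
  by move=> [/andP[-> _] ->].
by move=> /andP[-> vu]; rewrite vu (lt_trans vu)//; case/andP: ui.
Qed.

Lemma section_lengthE u : 0 <= u < 1 -> section_length c u = cell_length c u.
Proof.
move=> /(cell_exists c)[j uj]; rewrite /section_length /cell_index.
case: pickP => [i /cell_lengthE ->//|/(_ j)].
by rewrite uj.
Qed.

Lemma section_rootE u : 0 <= u < 1 -> section_root c u = cell_root c u.
Proof.
move=> /(cell_exists c)[j uj]; rewrite /section_root /cell_index.
case: pickP => [i /cell_rootE ->//|/(_ j)].
by rewrite uj.
Qed.

Lemma cell_root_itv u : 0 <= u < 1 -> 0 <= cell_root c u < 1.
Proof.
move=> /(cell_exists c)[j uj]; rewrite (cell_rootE uj).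
case/andP: uj => ju uj; have lj := le_lt_trans ju uj.
rewrite divr_ge0 ?subr_ge0 ?(ltW lj)//=.
by rewrite ltr_pdivrMr ?subr_gt0// mul1r ltrD2r.
Qed.

Lemma measurable_cell_root1 : measurable_fun setT (cell_root c).
Proof. exact: (@measurable_cell_root _ R (fun i _ => c i) id). Qed.

(** In each cell the rescaled root is below [x] on an initial segment whose
    length is [x] times that of the cell; the lengths of the cells add up to 1. *)
Lemma unif_cell_root_lt x : 0 < x -> x <= 1 ->
  unif (cell_root c @^-1` `]-oo, x[) = x%:E.
Proof.
move=> x0 x1; pose b (i : 'I_K.+1) := os i + x * (os i.+1 - os i).
have len0 (i : 'I_K.+1) : 0 <= os i.+1 - os i.
  by rewrite subr_ge0 order_stat_le.
have bi (i : 'I_K.+1) : os i <= b i by rewrite lerDl mulr_ge0// ltW.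
have bi1 (i : 'I_K.+1) : b i <= os i.+1.
  by rewrite -lerBrDl ler_piMl.
have -> : unif (cell_root c @^-1` `]-oo, x[) =
    unif (\big[setU/set0]_(i < K.+1) `[os i, b i[%classic).
  rewrite [LHS]unif_setI01; last first.
    by rewrite -[X in measurable X]setTI; apply: measurable_cell_root1.
  congr (unif _); rewrite -bigcup_mkord_ord; apply/seteqP; split => u /=.
    rewrite !in_itv/= => -[rux u01].
    have [j uj] := cell_exists c u01; exists j => //=.
    have /andP[ju uj1] := uj; rewrite in_itv/= inord_val ju/=.
    move: rux; rewrite (cell_rootE uj) ltr_pdivrMr ?ltrBlDl//.
    by rewrite subr_gt0; case/andP: uj; exact: le_lt_trans.
  move=> [k _ /=]; move: (inord k) => j; rewrite !in_itv/= => /andP[ju ub].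
  have uj : os j <= u < os j.+1 by rewrite ju (lt_le_trans ub).
  have /andP[j0 _] := os01 (ltnW (ltn_ord j)).
  have /andP[_ j1] := os01 (ltn_ord j).
  split; last by rewrite (le_trans j0)//= (lt_le_trans ub)// (le_trans (bi1 j)).
  rewrite (cell_rootE uj) ltr_pdivrMr ?ltrBlDl//.
  by rewrite subr_gt0; case/andP: uj; exact: le_lt_trans.
have -> : unif (\big[setU/set0]_(i < K.+1) `[os i, b i[%classic) =
    (\sum_(i < K.+1) unif `[os i, b i[)%E.
  apply: (@measure_bigsetU_ord _ _ _ unif K.+1 xpredT
    (fun i => `[os i, b i[%classic)) => //.
  move=> i j _ _ [u []]; rewrite /= !in_itv/= => /andP[iu ui] /andP[ju uj].
  apply: (@cell_unique _ _ c c01 _ _ u).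
    by rewrite iu (lt_le_trans ui).
  by rewrite ju (lt_le_trans uj).
transitivity (\sum_(i < K.+1) (x * (os i.+1 - os i))%:E)%E.
  apply: eq_bigr => i _; have /andP[i0 _] := os01 (ltnW (ltn_ord i)).
  have /andP[_ i1] := os01 (ltn_ord i).
  by rewrite unif_itv// ?(le_trans (bi1 i))// /b addrAC subrr add0r.
rewrite sumEFin -mulr_sumr -(big_mkord xpredT (fun i => os i.+1 - os i)).
by rewrite telescope_sumr// order_stat_last order_stat0 subr0 mulr1.
Qed.

(** The root stays uniform for every fixed choice of the cuts in [0, 1], not only
    on average over them. *)
Lemma unif_cell_root (A : set R) : measurable A ->
  unif (cell_root c @^-1` A) = unif A.
Proof.
have mroot : measurable_fun (setT : set (measurableTypeR R))
  (cell_root c : measurableTypeR R -> measurableTypeR R).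
  exact: measurable_cell_root1.
pose X : {mfun measurableTypeR R >-> measurableTypeR R} :=
  HB.pack (cell_root c) (isMeasurableFun.Build _ _ _ _ _ mroot).
move=> mA; have XE : distribution unif X A = unif (cell_root c @^-1` A) by [].
rewrite -XE; apply: (unif_cdf_unique _ mA).
exact: unif_cell_root_lt.
Qed.

End cellE.
End cell_measure.

(** * Independence of one variable from the sigma-algebra of the others *)

Lemma mutually_independent_inj d (Omega : measurableType d) (R : realType)
    (P : probability Omega R) (I J : eqType) (X : I -> {RV P >-> R})
    (f : J -> I) :
  injective f -> mutually_independent X -> mutually_independent (X \o f).
Proof.
move=> finj indep s A us mA.
(* The events of [X] have to be indexed by [I]: for [i] equal to [f j] the
   intersection has the single term [A j]. *)
pose A' i := \bigcap_(j in f @^-1` [set i]) A j.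
have A'E j : A' (f j) = A j.
  rewrite /A' (_ : _ @^-1` _ = [set j]) ?bigcap_set1//.
  by apply/seteqP; split => k /=; [exact: finj|move=> ->].
have := indep (map f s) A'; rewrite big_map map_inj_uniq// => /(_ us).
under eq_bigr do rewrite A'E.
move=> <-; last by move=> _ /mapP[j js ->]; rewrite A'E; exact: mA.
congr (P _); apply/seteqP; split => w sw.
  by move=> _ /mapP[j js ->]; rewrite A'E; exact: sw.
by move=> j js; have := sw (f j); rewrite A'E; apply; rewrite /= map_f.
Qed.

Section independence.
Context {d : measure_display} {Omega : measurableType d} {R : realType}.
Variables (P : probability Omega R) (I : eqType) (X : option I -> {RV P >-> R}).

(** Together, these events form a pi-system that generates the sigma-algebra of
    the variables with an index [Some i]. *)
Definition cylinders : set (set Omega) :=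
  [set B | exists s : seq I, exists2 A : I -> set R,
    uniq s /\ (forall i, measurable (A i)) &
    B = \bigcap_(i in [set` s]) (X (Some i) @^-1` A i)].

Let mpre i A : measurable A -> measurable (X i @^-1` A).
Proof.
by move=> mA; rewrite -[Y in measurable Y]setTI; exact: measurable_funP.
Qed.

Lemma measurable_cylinder : cylinders `<=` measurable.
Proof.
move=> _ [s [A [_ mA] ->]]; apply: fin_bigcap_measurable => // i _.
exact: mpre.
Qed.

Lemma setI_closed_cylinders : setI_closed cylinders.
Proof.
move=> _ _ [s [A [us mA] ->]] [t [B [ut mB] ->]].
exists (undup (s ++ t)), (fun i => (if i \in s then A i else setT) `&`
    (if i \in t then B i else setT)); first split.
- exact: undup_uniq.
- by move=> i; apply: measurableI; case: ifP.
apply/seteqP; split => w /=.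
  move=> [sw tw] i /= _; split; case: ifP => //.
  - exact: sw.
  - exact: tw.
move=> stw; split => i /= ii.
  by have := stw i; rewrite /= mem_undup mem_cat ii => /(_ isT) [].
by have := stw i; rewrite /= mem_undup mem_cat ii orbT => /(_ isT) [].
Qed.

Hypothesis indep : mutually_independent X.

(** The product rule extends from the cylinders to the sigma-algebra which they
    generate, because both sides are finite measures in [G]. *)
Lemma independent_cylinders A G : measurable A -> <<s cylinders >> G ->
  P (X None @^-1` A `&` G) = (P (X None @^-1` A) * P G)%E.
Proof.
move=> mA sG; have mXA := mpre None mA.
pose a : {nonneg R} := NngNum (fine_ge0 (measure_ge0 P (X None @^-1` A))).
have -> : P (X None @^-1` A `&` G) = mrestr P mXA G.
  by rewrite /mrestr setIC.
have aE B : mscale a P B = (P (X None @^-1` A) * P B)%E.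
  by rewrite /mscale/= fineK// fin_num_measure.
rewrite -aE.
apply: (@g_sigma_algebra_measure_unique _ R Omega cylinders _ (fun=> setT)
  _ _ (mrestr P mXA) (mscale a P) _ _ _ G sG).
- exact: measurable_cylinder.
- move=> _; exists [::], (fun=> setT); first by [].
  by apply/esym/seteqP; split.
- by rewrite bigcup_const//; exists 0%N.
- exact: setI_closed_cylinders.
- move=> _ [s [B [us mB] ->]].
  pose B' (k : option I) := if k is Some i then B i else A.
  have uSs : uniq (None :: map Some s).
    rewrite /= map_inj_uniq ?us ?andbT; last exact: Some_inj.
    by apply/mapP => -[].
  have mB' i : i \in None :: map Some s -> measurable (B' i).
    by move=> _; case: i => [i|]; [exact: mB|exact: mA].
  have := indep uSs mB'.
  rewrite big_cons big_map => PE.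
  have PC : P (\bigcap_(i in [set` s]) X (Some i) @^-1` B i) =
      (\prod_(i <- s) P (X (Some i) @^-1` B i))%E.
    by have := mutually_independent_inj (@Some_inj _) indep us (fun i _ => mB i).
  rewrite [RHS]aE PC -PE.
  congr (P _); apply/seteqP; split => w.
    move=> [sw Aw] [i|] //=; rewrite inE/= mem_map; last exact: Some_inj.
    exact: sw.
  move=> sw; split; last exact: (sw None).
  by move=> i /= si; apply: (sw (Some i)); rewrite /= inE/= map_f.
- move=> _; apply: (@le_lt_trans _ _ (P setT)); last first.
    by rewrite probability_setT ltry.
  by rewrite /mrestr; apply: le_measure; rewrite ?inE//; exact: measurableI.
Qed.

End independence.

Section freezing.
Context {d : measure_display} {Omega : measurableType d} {R : realType}.
Variables (P : probability Omega R) (I : eqType) (X : option I -> {RV P >-> R}).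
Hypothesis indep : mutually_independent X.
Local Notation gT := (g_sigma_algebraType (cylinders X)).

Lemma measurable_g_cylinders (i : I) :
  measurable_fun (setT : set gT) (X (Some i)).
Proof.
move=> _ B mB; rewrite setTI; apply: sub_sigma_algebra.
exists [:: i], (fun=> B); first by split.
apply/seteqP; split => w /=; last by move=> /(_ i); apply; rewrite /= inE.
by move=> Bw j /=; rewrite inE => /eqP ->.
Qed.

Lemma measurable_id_cylinders : measurable_fun setT (id : Omega -> gT).
Proof.
move=> _ B mB; rewrite setTI preimage_id.
exact: (smallest_sub (@sigma_algebra_measurable _ Omega)
  (@measurable_cylinder _ _ _ _ _ X)).
Qed.

Let idC : {mfun Omega >-> gT} :=
  HB.pack id (isMeasurableFun.Build _ _ _ _ _ measurable_id_cylinders).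

Hypothesis XNone : uniform01 (X None).

Let mpair : measurable_fun setT
  ((fun w => (X None w, w)) : Omega -> (measurableTypeR R * gT)%type).
Proof.
apply: measurable_fun_pair; last exact: measurable_id_cylinders.
exact: (@measurable_funPT _ _ _ R (X None)).
Qed.

Let pair_mfun : {mfun Omega >-> (measurableTypeR R * gT)%type} :=
  HB.pack (fun w => (X None w, w)) (isMeasurableFun.Build _ _ _ _ _ mpair).

(** As [f] is measurable in [w] for the sigma-algebra of the other variables,
    from which [X None] is independent, the joint law of [X None] and the sample
    point on this sigma-algebra is a product, and [X None] can be integrated out
    with [w] frozen. *)
Lemma integral_freeze (f : measurableTypeR R * gT -> \bar R) :
  measurable_fun setT f -> (forall z, 0 <= f z)%E ->
  (\int[P]_w f (X None w, w) =
   \int[P]_w \int[uniform_prob (@ltr01 R)]_u f (u, w))%E.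
Proof.
move=> mf f0.
transitivity (\int[distribution P pair_mfun]_z f z)%E.
  by rewrite ge0_integral_distribution.
transitivity (\int[uniform_prob (@ltr01 R) \x distribution P idC]_z f z)%E.
  apply: eq_measure_integral => A mA _.
  symmetry; apply: product_measure_unique => // B G mB mG.
  have := independent_cylinders indep mB mG.
  have := XNone mB; rewrite /distribution/pushforward => ->.
  exact.
rewrite fubini_tonelli2// ge0_integral_distribution//.
- exact: measurable_fun_fubini_tonelli_G.
- by move=> w; exact: integral_ge0.
Qed.

End freezing.

(** * Integrals over the unit square *)

Section integrals.
Context {R : realType}.
Local Notation mu := (@lebesgue_measure R).
Implicit Types (a b u v x : R).

Lemma integral_deriv_poly (p : {poly R}) a b : a <= b ->
  (\int[mu]_(x in `[a, b]) (p^`().[x])%:E)%E = (p.[b] - p.[a])%:E.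
Proof.
rewrite le_eqVlt => /predU1P[<-|ab].
  by rewrite set_itv1 integral_set1 subrr.
rewrite (@continuous_FTC2 _ _ (horner p))//.
- by apply: continuous_in_subspaceT => x _; exact: continuous_horner.
- split.
  + by move=> x _; exact: derivable_horner.
  + by apply: cvg_at_right_filter; exact: continuous_horner.
  + by apply: cvg_at_left_filter; exact: continuous_horner.
- by move=> x _; rewrite derivE.
Qed.

(** The two sides of [u] contribute the antiderivatives of (1 - u + v)^K and of
    (1 + u - v)^K. *)
Lemma integral_gap_pow (K : nat) u : 0 <= u <= 1 ->
  (\int[mu]_(v in `[0%R, 1%R]) ((1 - `|u - v|) ^+ K)%:E)%E =
  (K.+1%:R^-1 * (2 - (1 - u) ^+ K.+1 - u ^+ K.+1))%:E.
Proof.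
move=> /andP[u0 u1].
have K0 : K.+1%:R != 0 :> R by rewrite pnatr_eq0.
have mf (D : set R) : measurable_fun D (fun v => ((1 - `|u - v|) ^+ K)%:E).
  apply/measurable_EFinP/measurable_funX/measurable_funB => //.
  apply: measurableT_comp => //.
  exact: measurable_funB.
have -> : `[0, 1]%classic = `[0, u] `|` `]u, 1] :> set R.
  apply/seteqP; split => v /=; rewrite !in_itv/=.
    move=> /andP[-> ->].
    by rewrite andbT; case: (leP v u) => vu; [left|right].
  move=> [/andP[-> vu]|/andP[uv ->]].
    exact: le_trans vu u1.
  by rewrite (le_trans u0 (ltW uv)).
rewrite ge0_integral_setU//; [|exact: mf| |]; last 2 first.
- move=> v; rewrite /= !in_itv/= lee_fin => v01; apply: exprn_ge0.
  by rewrite subr_ge0 ler_norml; case: v01 => /andP[? ?]; lra.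
- apply/disj_setPS => v [/=]; rewrite !in_itv/= => /andP[_ vu] /andP[uv _].
  by move: (lt_le_trans uv vu); rewrite ltxx.
rewrite integral_itv_obnd_cbnd; last exact: mf.
pose p : {poly R} := K.+1%:R^-1 *: ('X + (1 - u)%:P) ^+ K.+1.
pose q : {poly R} := (- K.+1%:R^-1) *: ((1 + u)%:P - 'X) ^+ K.+1.
rewrite (_ : (\int[mu]_(v in `[0%R, u]) _)%E =
    (\int[mu]_(v in `[0%R, u]) (p^`().[v])%:E)%E); last first.
  apply: eq_integral => v; rewrite inE/= in_itv/= => /andP[v0 vu].
  rewrite /p derivZ deriv_exp derivD derivX derivC addr0 mul1r.
  rewrite !hornerE/= hornerMn !hornerE/= -[X in _ * X]mulr_natl mulKf//.
  rewrite ger0_norm ?subr_ge0//; congr ((_ ^+ _)%:E); ring.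
rewrite (_ : (\int[mu]_(v in `[u, 1%R]) _)%E =
    (\int[mu]_(v in `[u, 1%R]) (q^`().[v])%:E)%E); last first.
  apply: eq_integral => v; rewrite inE/= in_itv/= => /andP[uv v1].
  rewrite /q derivZ deriv_exp derivB derivX derivC sub0r mulN1r.
  rewrite !hornerE/= hornerMn !hornerE -[X in _ * X]mulr_natl.
  rewrite mulrN mulrNN mulKf//.
  rewrite ler0_norm ?subr_le0//; congr ((_ ^+ _)%:E); ring.
rewrite !integral_deriv_poly// -EFinD /p /q !hornerE/=; congr EFin.
rewrite (_ : u + 1 - u = 1) 1?addrAC ?subrr ?add0r//.
rewrite (_ : 1 + u - 1 = u) 1?addrAC ?subrr ?add0r//.
rewrite (_ : 1 + u - u = 1) ?addrK// !expr1n; ring.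
Qed.

Lemma integral_gap_pow_sum (K : nat) :
  (\int[mu]_(u in `[0%R, 1%R])
     (K.+1%:R^-1 * (2 - (1 - u) ^+ K.+1 - u ^+ K.+1))%:E)%E =
  (2 / (K%:R + 2))%:E.
Proof.
have K1 : K.+1%:R != 0 :> R by rewrite pnatr_eq0.
have K2 : K.+2%:R != 0 :> R by rewrite pnatr_eq0.
pose p : {poly R} := K.+1%:R^-1 *: (2 *: 'X +
  K.+2%:R^-1 *: ((1%:P - 'X) ^+ K.+2 - 'X ^+ K.+2)).
rewrite (_ : (\int[mu]_(u in `[0%R, 1%R]) _)%E =
    (\int[mu]_(v in `[0%R, 1%R]) (p^`().[v])%:E)%E); last first.
  apply: eq_integral => v _; congr EFin.
  rewrite /p derivZ derivD !derivZ derivX derivB !deriv_exp.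
  rewrite derivB derivX derivC sub0r mulN1r mul1r.
  rewrite -mulrnBl -[(_ - _) *+ _]scaler_nat.
  rewrite (scalerA K.+2%:R^-1) mulVf//.
  by rewrite scale1r !hornerE.
rewrite integral_deriv_poly// /p !hornerE/= !(subrr, subr0, expr0n, expr1n)/=.
congr EFin; rewrite -!natr1 in K1 K2 *; field; rewrite ?K1 ?K2//.
Qed.

End integrals.

(** * Integrals of functions that agree almost everywhere *)

Section ae_integral.
Context {d : measure_display} {T : measurableType d} {R : realType}.
Variable mu : {measure set T -> \bar R}.
Import HBNNSimple.

(** The integral of a nonnegative function is a supremum over the simple functions
    below it, and a simple function may be set to 0 on the null set without
    changing its integral. This serves for functions of unknown measurability
    that agree almost everywhere with a measurable one. *)
Lemma ge0_ae_le_integralT (f g : T -> \bar R) :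
  (forall x, 0 <= f x)%E -> (forall x, 0 <= g x)%E ->
  {ae mu, forall x, (f x <= g x)%E} ->
  (\int[mu]_x f x <= \int[mu]_x g x)%E.
Proof.
move=> f0 g0 [N [mN N0 fgN]].
rewrite ge0_integralTE// [leRHS]ge0_integralTE//.
apply: ge_ereal_sup => _ [h hf <-]; apply: ereal_sup_ubound.
exists (proj_nnsfun h (measurableC mN)).
  move=> x /=; rewrite mindicE; case: (boolP (x \in ~` N)) => xN.
    rewrite mulr1; apply: (le_trans (hf x)).
    move: xN; rewrite inE => xN; apply: contrapT => fg.
    by apply: xN; apply: fgN.
  by rewrite mulr0.
rewrite -!integralT_nnsfun; apply: ge0_ae_eq_integral => //.
- exact/measurable_EFinP.
- exact/measurable_EFinP.
- by move=> x _; rewrite lee_fin.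
- by move=> x _; rewrite lee_fin.
- have aeN : {ae mu, forall x, ~ N x}.
    by exists N; split => // x /= /contrapT.
  apply: filterS aeN => x xN _.
  by rewrite /= mindicE mem_set// mulr1.
Qed.

Lemma ge0_ae_eq_integralT (f g : T -> \bar R) :
  (forall x, 0 <= f x)%E -> (forall x, 0 <= g x)%E ->
  {ae mu, forall x, f x = g x} ->
  (\int[mu]_x f x = \int[mu]_x g x)%E.
Proof.
move=> f0 g0 fg; apply/eqP; rewrite eq_le.
by rewrite !ge0_ae_le_integralT//; apply: filterS fg => x ->.
Qed.

End ae_integral.

(** * The expected length of the cell of a uniform point *)

Section expected_cell_length.
Context {d : measure_display} {Omega : measurableType d} {R : realType}.
Variables (P : probability Omega R) (K : nat) (c : 'I_K -> {RV P >-> R}).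
Hypothesis c_unif : forall i, uniform01 (c i).
Hypothesis c_indep : mutually_independent c.

Lemma unif_same_side (u v : R) : 0 <= u <= 1 -> 0 <= v <= 1 ->
  unif [set x | (x <= u) == (x <= v)] = (1 - `|u - v|)%:E.
Proof.
wlog uv : u v / u <= v => [hw u01 v01|].
  have [|/ltW] := leP u v => uv; first exact: hw.
  rewrite distrC -hw//; congr (unif _); apply/seteqP.
  by split => x /=; rewrite eq_sym.
move=> /andP[u0 u1] /andP[v0 v1].
rewrite (_ : [set x | _] = ~` `]u, v]%classic); last first.
  apply/seteqP; split => x /=; rewrite in_itv/=.
    by move=> /eqP <-; case: leP.
  case: (leP x u) => xu /negP /=; first by rewrite (le_trans xu).
  by rewrite -ltNge => /lt_geF ->.
transitivity (1 - unif `]u, v])%E.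
  by apply: probability_setC; exact: measurable_itv.
by rewrite unif_itv// ler0_norm ?subr_le0// opprB EFinB.
Qed.

Lemma probability_same_cell (u v : R) : 0 <= u <= 1 -> 0 <= v <= 1 ->
  P [set w | same_cell (c^~ w) u v] = ((1 - `|u - v|) ^+ K)%:E.
Proof.
move=> u01 v01; pose A := [set x : R | (x <= u) == (x <= v)].
have mA : measurable A.
  rewrite (_ : A = [set x | same_cell (fun _ : 'I_1 => x) u v]).
    exact: (@measurable_same_cell R 1 _ R (fun _ => id) (fun=> u) (fun=> v)).
  apply/seteqP; split => x /=; first by move=> ?; apply/forallP.
  by move=> /forallP /(_ ord0).
rewrite (_ : [set w | _] = \bigcap_(i in [set` enum 'I_K]) c i @^-1` A).
  rewrite c_indep ?enum_uniq//.
  under eq_bigr do rewrite (c_unif _ mA : P _ = _) unif_same_side//.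
  rewrite big_enum/= prodEFin big_const_ord iter_mulr_1//.
apply/seteqP; split => w /=; first by move=> /forallP + i _ => /(_ i).
by move=> same; apply/forallP => i; apply: same; rewrite /= mem_enum.
Qed.

Let mc i : measurable_fun setT (c i).
Proof. exact: measurable_funPT. Qed.

Let same_u (u : R) : set (Omega * measurableTypeR R) :=
  [set z | same_cell (c^~ z.1) u z.2].

Let msame_u u : measurable (same_u u).
Proof.
apply: (@measurable_same_cell R K _ _ (fun i z => c i z.1) (fun=> u) snd) => //.
- by move=> i; exact: measurableT_comp.
Qed.

(** The expected length is the probability that two uniform points lie in the
    same cell; exchanging the integrals, the cuts are averaged first, for two fixed
    points. *)
Lemma expected_cell_length :
  (\int[P]_w \int[unif]_u (cell_length (c^~ w) u)%:E)%E = (2 / (K%:R + 2))%:E.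
Proof.
pose F (z : Omega * measurableTypeR R) := unif (xsection (same_u z.2) z.1).
have mF : measurable_fun setT F.
  have mZ : measurable [set z : Omega * measurableTypeR R * measurableTypeR R |
      same_cell (c^~ z.1.1) z.1.2 z.2].
    apply: (@measurable_same_cell R K _ _ (fun i z => c i z.1.1)
      (fun z => z.1.2) snd) => [i||].
    - by apply: measurableT_comp => //; exact: measurableT_comp.
    - exact: measurableT_comp.
    - exact: measurable_snd.
  have := measurable_fun_xsection unif mZ.
  by apply: eq_measurable_fun => z _ /=; rewrite /F !xsectionE.
transitivity (\int[P]_w \int[unif]_u F (w, u))%E.
  apply: eq_integral => w _; apply: eq_integral => u _.
  have := measurable_xsection w (msame_u u).
  rewrite /F/= xsectionE /cell_length => mS.
  by rewrite fineK//; exact: fin_num_measure.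
rewrite fubini_tonelli//.
have FE u : (\int[P]_w F (w, u) = \int[unif]_v P (ysection (same_u u) v))%E.
  have := indic_fubini_tonelli P unif (msame_u u).
  by rewrite indic_fubini_tonelli_FE// indic_fubini_tonelli_GE.
rewrite integral_uniform; [|exact: measurable_fun_fubini_tonelli_G|]; last first.
  by move=> u; apply: integral_ge0.
rewrite subr0 invr1 mul1e -integral_gap_pow_sum; apply: eq_integral => u.
rewrite inE/= in_itv/= => u01; rewrite FE integral_uniform//; last first.
  exact: measurable_fun_ysection.
rewrite subr0 invr1 mul1e -integral_gap_pow//; apply: eq_integral => v.
rewrite inE/= in_itv/= => v01.
by rewrite -probability_same_cell// ysectionE.
Qed.

End expected_cell_length.

(** * Iterated sections *)

Section iterated_root.
Context {R : realType} {K : nat}.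
Implicit Type c : nat -> 'I_K -> R.

Fixpoint iter_root c (n : nat) (u : R) : R :=
  if n is m.+1 then cell_root (c m) (iter_root c m u) else u.

Lemma measurable_iter_root d (T : measurableType d) (X : nat -> 'I_K -> T -> R)
    (f : T -> R) n :
  (forall m i, measurable_fun setT (X m i)) -> measurable_fun setT f ->
  measurable_fun setT (fun t => iter_root (fun m i => X m i t) n (f t)).
Proof.
move=> mX mf; elim: n => [//|n ih] /=.
exact: (@measurable_cell_root _ _ _ _ (X n)).
Qed.

Section deterministic_cuts.
Variable c : nat -> 'I_K -> R.
Hypothesis c01 : forall n i, 0 <= c n i <= 1.

Lemma section_root_iter (r : nat -> R) :
  0 <= r 0 < 1 -> (forall n, r n.+1 = section_root (c n) (r n)) ->
  forall n, r n = iter_root c n (r 0) /\ 0 <= r n < 1.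
Proof.
move=> r01 rS; elim=> [//|n [rn rn01]].
rewrite rS (section_rootE (c01 n) rn01); split; first by rewrite /= -rn.
exact: (cell_root_itv (c01 n)).
Qed.

Let measurable_iter_root1 n : measurable_fun setT (iter_root c n).
Proof. exact: (@measurable_iter_root _ R (fun m i _ => c m i) id). Qed.

Lemma unif_iter_root n (A : set R) : measurable A ->
  unif (iter_root c n @^-1` A) = unif A.
Proof.
elim: n A => [//|n ih] A mA.
rewrite -[RHS](unif_cell_root (c01 n) mA) -[RHS]ih//.
by rewrite -[X in measurable X]setTI; apply: measurable_cell_root1.
Qed.

Lemma integral_unif_iter_root n (f : R -> \bar R) :
  measurable_fun setT f -> (forall u, 0 <= f u)%E ->
  (\int[unif]_u f (iter_root c n u) = \int[unif]_u f u)%E.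
Proof.
move=> mf f0.
have mr : measurable_fun (setT : set (measurableTypeR R))
  (iter_root c n : measurableTypeR R -> measurableTypeR R).
  exact: measurable_iter_root1.
pose Y : {mfun measurableTypeR R >-> measurableTypeR R} :=
  HB.pack (iter_root c n) (isMeasurableFun.Build _ _ _ _ _ mr).
transitivity (\int[distribution unif Y]_u f u)%E.
  by rewrite ge0_integral_distribution.
by apply: eq_measure_integral => A mA _; exact: unif_iter_root.
Qed.

End deterministic_cuts.
End iterated_root.

Section almost_sure.
Context {d : measure_display} {Omega : measurableType d} {R : realType}.
Variable P : probability Omega R.

Lemma uniform01_ae (X : {RV P >-> R}) : uniform01 X ->
  {ae P, forall w, 0 <= X w < 1}.
Proof.
move=> Xu; pose I := `[0, 1[%classic : set R.
have mI : measurable I by exact: measurable_itv.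
exists (X @^-1` ~` I); split.
- rewrite -[Y in measurable Y]setTI; apply: measurable_funPT => //.
  exact: measurableC.
- rewrite [LHS](Xu _ (measurableC mI)) unif_setI01 ?setICl ?measure0//.
  exact: measurableC.
- by move=> w /=; apply: contra_not; rewrite /I/= in_itv.
Qed.

End almost_sure.

Theorem corollary17 (R : realType) (d : measure_display)
    (Omega : measurableType d) (P : probability Omega R)
    (K : nat) (hK : (1 <= K)%N)
    (r0 : {RV P >-> R}) (c : nat -> 'I_K -> {RV P >-> R})
    (r0_unif : uniform01 r0)
    (c_unif : forall (n : nat) (i : 'I_K), uniform01 (c n i))
    (indep : mutually_independent (root_and_cuts r0 c))
    (r ell : nat -> Omega -> R)
    (r_init : forall w : Omega, r 0%N w = r0 w)
    (r_step : forall (n : nat) (w : Omega),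
      r n.+1 w = section_root (fun i : 'I_K => c n i w) (r n w))
    (ell_step : forall (n : nat) (w : Omega),
      ell n.+1 w = section_length (fun i : 'I_K => c n i w) (r n w)) :
  forall n : nat, (0 < n)%N ->
    ('E_P[ell n] = (2 / (K%:R + 2))%:E)%E.
Proof.
case=> [//|n] _.
pose C w m i := c m i w.
have C01 : {ae P, forall w, forall m i, 0 <= C w m i <= 1}.
  apply/ae_foralln => m; apply: filter_forall => i.
  by apply: filterS (uniform01_ae (c_unif m i)) => w /andP[-> /ltW].
pose f (z : measurableTypeR R *
    g_sigma_algebraType (cylinders (root_and_cuts r0 c))) :=
  (cell_length (C z.2 n) (iter_root (C z.2) n z.1))%:E.
have f0 z : (0 <= f z)%E by rewrite lee_fin fine_ge0.
have mC m i : measurable_fun setT (fun z : measurableTypeR R *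
    g_sigma_algebraType (cylinders (root_and_cuts r0 c)) => C z.2 m i).
  have mc := @measurable_g_cylinders _ _ _ P _ (root_and_cuts r0 c) (m, i).
  by apply: (measurableT_comp mc); exact: measurable_snd.
have mf : measurable_fun setT f.
  apply/measurable_EFinP.
  have mroot := @measurable_iter_root _ _ _ _ _ _ n mC measurable_fst.
  exact: (measurable_cell_length (mC n) mroot).
have ell0 w : 0 <= ell n.+1 w.
  rewrite ell_step /section_length /cell_index; case: pickP => // i /andP[ir ri].
  by rewrite subr_ge0 (le_trans ir)// ltW.
have c_indep : mutually_independent (c n).
  have cut_inj : injective (fun i : 'I_K => Some (n, i)) by move=> i j [].
  exact: (mutually_independent_inj cut_inj indep).
rewrite unlock.
(* The length is exchanged for the jointly measurable [f]; they agree when the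
   cuts lie in [0, 1] and the initial root in [0, 1[. *)
transitivity (\int[P]_w f (r0 w, w))%E.
  apply: ge0_ae_eq_integralT => //.
  near=> w.
  have Cw : forall m i, 0 <= C w m i <= 1 by near: w.
  have r01 : 0 <= r 0 w < 1.
    by rewrite r_init; near: w; exact: uniform01_ae.
  have [rn rn01] := section_root_iter Cw r01 (fun m => r_step m w) n.
  rewrite ell_step (section_lengthE (Cw n) rn01) rn r_init//.
rewrite (integral_freeze indep r0_unif mf f0).
rewrite -(expected_cell_length (c_unif n) c_indep).
apply: ge0_ae_eq_integralT.
- by move=> w; exact: integral_ge0.
- by move=> w; apply: integral_ge0 => u _; rewrite lee_fin fine_ge0.
apply: filterS C01 => w Cw.
apply: (integral_unif_iter_root Cw n (f := fun u => (cell_length (C w n) u)%:E)).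
- apply/measurable_EFinP.
  exact: (@measurable_cell_length _ _ _ R (fun i _ => C w n i) id).
- by move=> u; rewrite lee_fin fine_ge0.
Unshelve. all: by end_near.
Qed.
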